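(* There exist integers $q_k$, one for each positive integer $k$, such that for every $k$ and every prime power $q \ge q_k$, $$\mathcal{F}(\mathcal{I}_{1,q}) > \mathcal{F}(\mathcal{I}_{2,q}) > \cdots > \mathcal{F}(\mathcal{I}_{k,q}),$$ and such that $q_k = O(k^2 4^k)$ as $k \to \infty$. In particular, $q_k < 4.03\,(k-1)^2\, 4^k\, \zeta(k)^2$ for all $k \ge 2$.
   Context: For a prime power $q$ and $k \ge 1$, $\mathcal{I}_{k,q}$ is the set of monic polynomials in $\mathbb{F}_q[x]$ with exactly $k$ monic irreducible factors counted with multiplicity. For a set $A$ of nonconstant monic polynomials in $\mathbb{F}_q[x]$, $\mathcal{F}(A) = \sum_{a \in A} \frac{1}{q^{\deg a} \deg a}$. $\zeta$ is the Riemann zeta function. *)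

(* Defs.v *)
From HB Require Import structures.
From mathcomp Require Import all_boot all_order all_algebra.
From mathcomp Require Import all_classical all_reals all_analysis.

Set Implicit Arguments.
Unset Strict Implicit.
Unset Printing Implicit Defensive.

Import Order.TTheory GRing.Theory Num.Theory.
Import numFieldNormedType.Exports.

Local Open Scope classical_set_scope.
Local Open Scope ring_scope.

Definition deg (K : nzRingType) (p : {poly K}) : nat := (size p).-1.

(* By unique factorization, a polynomial has exactly k monic irreducible
   factors counted with multiplicity iff it is the product of a list (with
   repetitions allowed) of k monic irreducible polynomials; such a product is
   itself monic. *)
Definition irrprod (K : fieldType) (k : nat) : set {poly K} :=
  [set p | exists s : seq {poly K},
    [/\ size s = k,
        (forall f, f \in s -> f \is monic /\ irreducible_poly f) &
        p = \prod_(f <- s) f]].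
Arguments irrprod : clear implicits.

(* Intended for sets A of nonconstant monic polynomials (a constant would
   contribute 0^-1 = 0). The terms are nonnegative, so the (possibly infinite) sum is unordered and
   takes its value in the extended reals. *)
Definition erdos_sum (R : realType) (K : finFieldType) (A : set {poly K})
  : \bar R :=
  \esum_(a in A) ((#|K|%:R ^+ deg a * (deg a)%:R)^-1)%:E.

(* The Dirichlet series, meaningful for s > 1. *)
Definition zeta (R : realType) (s : R) : R :=
  limn (series (fun n : nat => n.+1%:R `^ (- s))).

(* Main.v *)
(* Write x = 1/q, let h_k(n) be the proportion of products of k irreducibles
   among the monic polynomials of degree n, and put a_d = d pi_d / q^d, where
   pi_d counts the monic irreducibles of degree d.  Summing
     deg f = sum_{p, e >= 1, p^e | f} deg p
   over such products f of degree n gives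
     n h_k(n) = sum_{d, e} a_d x^((e-1)d) h_{k-e}(n - ed),
   and the same sum over all monic f gives 1 - 2x <= a_d <= 1.  Hence, for
   q >= 4, n h_{k+1}(n) lies between (1/2) sum_{j<n} h_k(j) and
   sum_{j<n} h_k(j) + 2x.
   Let F_k = sum_n h_k(n) / n.  The upper bound and
   sum_{n>j} 1/n^2 <= (1/j + 1/(j+1)) / 2 give
     F_{k+1} <= F_k - (1/2) sum_n h_k(n) / (n(n+1)) + 2x.
   The weight v(n) = 1/((n+1)(n+2)) satisfies sum_{n>j} v(n)/n = v(j)/2, so
   the lower bound gives sum_n h_k(n) v(n) >= 4^-k / 2.  Altogether
   F_{k+1} <= F_k - 4^-k / 4 + 2x, which is less than F_k once q >= 16 * 4^k,
   so q_k = 4 (k-1)^2 4^k works. *)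
Require Import Defs.
From HB Require Import structures.
From mathcomp Require Import all_boot all_order all_algebra.
From mathcomp Require Import all_classical all_reals all_analysis.
From mathcomp Require Import ring lra zify.

Set Implicit Arguments.
Unset Strict Implicit.
Unset Printing Implicit Defensive.

Import Order.TTheory GRing.Theory Num.Theory.
Import numFieldNormedType.Exports.

Local Open Scope classical_set_scope.
Local Open Scope ring_scope.

(** * Unique factorization of monic polynomials *)

Definition monic_irr (K : fieldType) (p : {poly K}) :=
  p \is monic /\ irreducible_poly p.

Section UniqueFactorization.
Variable K : fieldType.
Implicit Types (p f g : {poly K}) (s : seq {poly K}).

Lemma irred_dvdpM p f g :
  irreducible_poly p -> (p %| f * g) = (p %| f) || (p %| g).
Proof.
move=> irrp; apply/idP/orP => [pfg|[]]; last 2 first.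
- exact: dvdp_mulr.
- exact: dvdp_mull.
have [|npf] := boolP (p %| f); first by left.
by right; move: pfg; rewrite Gauss_dvdpr// irreducible_poly_coprime.
Qed.

Lemma monic_irr_dvdp p g : monic_irr p -> monic_irr g -> (p %| g) = (p == g).
Proof.
move=> [mp irrp] [mg irrg]; apply/idP/eqP => [pg|->//].
have /irrg : size p != 1%N by rewrite neq_ltn irrp.1 orbT.
by move=> /(_ pg); rewrite eqp_monic// => /eqP.
Qed.

Lemma monic_prod_irr s :
  (forall f, f \in s -> monic_irr f) -> \prod_(f <- s) f \is monic.
Proof. by move=> sP; rewrite big_seq; apply: monic_prod => f /sP[]. Qed.

Lemma monic_irr_dvdp_prod p s : monic_irr p ->
  (forall f, f \in s -> monic_irr f) -> p %| \prod_(f <- s) f -> p \in s.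
Proof.
move=> pP; elim: s => [|g s IHs] sP.
  by rewrite big_nil dvdp1 => /eqP p1; case: pP => _ []; rewrite p1.
have gP : monic_irr g by apply: sP; rewrite mem_head.
rewrite big_cons irred_dvdpM; last by case: pP.
rewrite monic_irr_dvdp// in_cons; case/orP=> [->//|ps].
by rewrite IHs ?orbT// => f fs; apply: sP; rewrite in_cons fs orbT.
Qed.

(** By Euclid's lemma [p] occurs in any factorization of [p * g], so one copy of it can be removed
    and cancelled. *)
Lemma irrprodM p g k : monic_irr p ->
  irrprod K k.+1 (p * g) <-> irrprod K k g.
Proof.
move=> pP; split=> [[s [sk sP pgE]]|[s [sk sP ->]]].
  have ps : p \in s by apply: monic_irr_dvdp_prod => //; rewrite -pgE dvdp_mulr.
  exists (rem p s); split; first by rewrite size_rem// sk.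
    by move=> f /mem_rem/sP.
  move: pgE; rewrite (perm_big _ (perm_to_rem ps)) big_cons/=.
  by apply: mulfI; rewrite monic_neq0//; case: pP.
exists (p :: s); split; rewrite ?big_cons//=; first by rewrite sk.
by move=> f; rewrite in_cons => /orP[/eqP->|/sP].
Qed.

Lemma irrprod0 p g : monic_irr p -> ~ irrprod K 0 (p * g).
Proof.
move=> [_ [p1 _]] [s [/size0nil-> _]]; rewrite big_nil => pg1.
by have : p %| 1 by [rewrite -pg1 dvdp_mulr]; rewrite dvdp1 => /eqP p1'; rewrite p1' in p1.
Qed.

(** This is what turns h_k into h_{k-e} in the recursion: stripping p^e off a product of k
    irreducibles leaves a product of k - e. *)
Lemma irrprodXM p g e k : monic_irr p ->
  irrprod K k (p ^+ e * g) <-> (e <= k)%N /\ irrprod K (k - e) g.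
Proof.
move=> pP; elim: e k => [|e IHe] k; first by rewrite expr0 mul1r subn0; split=> [|[]].
rewrite exprS -mulrA; case: k => [|k]; last by rewrite irrprodM// IHe.
by split=> [/(irrprod0 pP)|[]].
Qed.

Lemma dvdp_expr_prod p s e : monic_irr p ->
  (forall f, f \in s -> monic_irr f) ->
  (p ^+ e %| \prod_(f <- s) f) = (e <= count_mem p s)%N.
Proof.
move=> pP; have p0 : p != 0 by rewrite monic_neq0//; case: pP.
elim: e s => [|e IHe] s sP; first by rewrite expr0 dvd1p.
have [ps|nps] := boolP (p \in s).
  rewrite (perm_big _ (perm_to_rem ps)) big_cons/= exprS dvdp_mul2l//.
  rewrite IHe; last by move=> f /mem_rem/sP.
  by rewrite (permP (perm_to_rem ps))/= eqxx.
rewrite (count_memPn nps); apply/negP => /(dvdp_trans _) pes.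
by move/negP: nps; apply; apply: monic_irr_dvdp_prod => //; apply: pes; rewrite exprS dvdp_mulr.
Qed.

Lemma deg_prod_irr s : (forall f, f \in s -> monic_irr f) ->
  deg (\prod_(f <- s) f) = (\sum_(f <- s) deg f)%N.
Proof.
elim: s => [|g s IHs] sP; first by rewrite !big_nil /deg size_poly1.
have sP' f : f \in s -> monic_irr f by move=> fs; apply: sP; rewrite in_cons fs orbT.
have [mg _] : monic_irr g by apply: sP; rewrite mem_head.
rewrite !big_cons -IHs// /deg size_Mmonic ?monic_neq0 ?monic_prod_irr//.
have := monic_neq0 mg; rewrite -size_poly_gt0.
have := monic_neq0 (monic_prod_irr sP'); rewrite -size_poly_gt0.
by case: (size g) (size _) => [|a] [|b]//= _ _; rewrite addnS.
Qed.

(** Strong induction on the size: a reducible [f] splits into two monic factors of smaller size. *)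
Lemma monic_irr_factor f : f \is monic ->
  exists2 s, (forall g, g \in s -> monic_irr g) & f = \prod_(g <- s) g.
Proof.
have [n] := ubnP (size f); elim: n f => // n IHn f; rewrite ltnS => fn mf.
have [f1|f1] := eqVneq (size f) 1%N.
  exists [::] => //; rewrite big_nil; move: (f1) => /eqP/size_poly1P[c c0 fc].
  by move: mf; rewrite fc monicE lead_coefC => /eqP->.
have f_gt1 : (1 < size f)%N by rewrite ltn_neqAle eq_sym f1 size_poly_gt0 monic_neq0.
have [irrf|] := pselect (irreducible_poly f).
  by exists [:: f]; rewrite ?big_seq1// => g; rewrite inE => /eqP->.
move=> /not_andP[//|/existsNP[d /not_implyP[d1 /not_implyP[df /negP ndf]]]].
have d0 : d != 0 by apply: contraTneq df => ->; rewrite dvd0p monic_neq0.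
(* The proper divisor [d] need not be monic; rescaling makes it so, and the cofactor is then monic
   too. *)
pose p := (lead_coef d)^-1 *: d.
have lp : lead_coef d != 0 by rewrite lead_coef_eq0.
have mp : p \is monic by rewrite monicE lead_coefZ mulVf.
have pd : p %= d by rewrite eqp_scale// invr_eq0.
have pf : p %| f by rewrite (eqp_dvdl _ pd).
have sp : size p = size d by rewrite size_scale// invr_eq0.
have [g fE] : exists g, f = g * p by exists (f %/ p); rewrite divpK.
have mg : g \is monic by rewrite -(monicMr _ mp) -fE.
have szf : size f = (size g + size p).-1 by rewrite fE size_Mmonic ?monic_neq0.
have g0 : (0 < size g)%N by rewrite size_poly_gt0 monic_neq0.
have p0 : (0 < size p)%N by rewrite size_poly_gt0 monic_neq0.
have p_gt1 : (1 < size p)%N by rewrite ltn_neqAle eq_sym p0 sp d1.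
have g_gt1 : (1 < size g)%N.
  rewrite ltn_neqAle g0 andbT eq_sym; apply: contra ndf => /eqP g1.
  by rewrite -(dvdp_size_eqp df) -sp szf g1.
have [||s1 s1P gE] := IHn g => //.
  apply: leq_trans fn; rewrite szf; case: (size p) p_gt1 => [|[|b]]// _.
  by rewrite addnS/= addnS ltnS leq_addr.
have [||s2 s2P pE] := IHn p => //.
  apply: leq_trans fn; rewrite szf; case: (size g) g_gt1 => [|[|b]]// _.
  by rewrite !addSn/= ltnS leq_addl.
exists (s1 ++ s2); last by rewrite big_cat/= -gE -pE.
by move=> h; rewrite mem_cat => /orP[/s1P|/s2P].
Qed.

End UniqueFactorization.

(** * Counting monic polynomials by degree *)

Section Counting.
Variable K : finFieldType.
Implicit Types (p f g : {poly K}) (n d e k : nat).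

(** Adding X^n to each polynomial of degree below n gives an explicit duplicate-free list, so
    counting becomes [count] over a sequence. *)
Definition monics n : seq {poly K} :=
  [seq 'X^n + (val t : {poly K}) | t <- enum {poly_n K}].

Lemma mem_monics n f : (f \in monics n) = (f \is monic) && (size f == n.+1).
Proof.
have szX (t : {poly_n K}) : (size (val t) < size ('X^n : {poly K})%R)%N.
  by rewrite size_polyXn ltnS size_npoly.
apply/mapP/andP => [[t _ ->]|[mf /eqP sf]].
  by rewrite monicE lead_coefDl// lead_coefXn size_polyDl// size_polyXn !eqxx.
have st : (size (f - 'X^n)%R <= n)%N.
  apply/leq_sizeP => j; rewrite leq_eqVlt => /predU1P[<-|nj].
    rewrite coefB coefXn eqxx; move: mf; rewrite monicE /lead_coef sf => /eqP->.
    by rewrite subrr.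
  rewrite coefB coefXn gtn_eqF// subr0; apply: nth_default.
  by rewrite sf.
by exists (NPoly st); rewrite ?mem_enum//= addrC subrK.
Qed.

Lemma uniq_monics n : uniq (monics n).
Proof. by rewrite map_inj_uniq ?enum_uniq// => s t /addrI/val_inj. Qed.

Lemma size_monics n : size (monics n) = (#|K| ^ n)%N.
Proof. by rewrite size_map -cardE card_npoly. Qed.

Lemma monicsM n m f g : f \in monics n -> g \in monics m ->
  f * g \in monics (n + m).
Proof.
rewrite !mem_monics => /andP[mf /eqP sf] /andP[mg /eqP sg].
by rewrite monicMl// mg size_Mmonic ?monic_neq0// sf sg addnS/= addSn eqxx.
Qed.

Lemma monicsX d p e : p \in monics d -> p ^+ e \in monics (e * d).
Proof.
move=> pd; elim: e => [|e IHe]; last by rewrite exprS mulSn monicsM.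
by rewrite expr0 mul0n mem_monics monic1 size_poly1.
Qed.

(** * Irreducibles of given degree and the degree as a sum of valuations *)

Definition irreds d := [seq p <- monics d | `[< irreducible_poly p >]].

Lemma mem_irreds d p :
  p \in irreds d <-> monic_irr p /\ deg p = d.
Proof.
rewrite mem_filter mem_monics /monic_irr /deg; split.
  by move=> /andP[/asboolP ? /andP[? /eqP->]].
move=> [[mp ip] <-]; rewrite mp asboolT//= prednK//.
by rewrite size_poly_gt0 monic_neq0.
Qed.

Lemma deg_irred_gt0 p : monic_irr p -> (0 < deg p)%N.
Proof. by move=> [_ [+ _]]; rewrite /deg; case: (size p) => [|[]]. Qed.

Lemma sum_irreds_eq M g : monic_irr g -> (deg g <= M)%N ->
  (\sum_(1 <= d < M.+1) \sum_(p <- irreds d) d * (p == g) = deg g)%N.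
Proof.
move=> gP gM; rewrite (bigD1_seq (deg g)) ?iota_uniq ?mem_index_iota ?deg_irred_gt0//=.
rewrite (bigD1_seq g) ?filter_uniq ?uniq_monics//=; last by apply/mem_irreds.
rewrite eqxx muln1 big1 ?addn0; last by move=> p /negPf->; rewrite muln0.
rewrite big1_seq ?addn0// => d /andP[dg _]; rewrite big1_seq// => p /andP[_ /mem_irreds[_ pd]].
have [pg|] := eqVneq p g; last by rewrite muln0.
by move: dg; rewrite -pd pg eqxx.
Qed.

(** Both sides add up deg p over the prime factors of [f] with multiplicity, since p^e divides [f]
    for exactly v_p(f) values e >= 1. The free bound [M] lets identities for different n share their
    summation ranges. *)
Lemma deg_valuations f n M : f \in monics n -> (n <= M)%N ->
  (\sum_(1 <= d < M.+1) \sum_(p <- irreds d) \sum_(1 <= e < M.+1)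
     d * (p ^+ e %| f)%R = n)%N.
Proof.
rewrite mem_monics => /andP[mf /eqP sf] nM.
have df : deg f = n by rewrite /deg sf.
have [s sP fE] := monic_irr_factor mf.
have ds : (\sum_(g <- s) deg g)%N = n by rewrite -deg_prod_irr// -fE.
have sM : (size s <= M)%N.
  apply: leq_trans nM; rewrite -ds -sum1_size !big_seq.
  by apply: leq_sum => g /sP; exact: deg_irred_gt0.
rewrite -[RHS]ds; transitivity (\sum_(g <- s) \sum_(1 <= d < M.+1)
    \sum_(p <- irreds d) d * (p == g))%N; last first.
  rewrite !big_seq; apply: eq_bigr => g gs; apply: sum_irreds_eq; first exact: sP.
  apply: leq_trans nM; rewrite -ds (perm_big _ (perm_to_rem gs)) big_cons.
  exact: leq_addr.
rewrite [RHS]exchange_big/=; apply: eq_bigr => d _.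
rewrite [RHS]exchange_big/= big_seq [RHS]big_seq; apply: eq_bigr => p /mem_irreds[pP _].
rewrite -!big_distrr/=; congr (_ * _)%N.
transitivity (\sum_(1 <= e < M.+1) nat_of_bool (e <= count_mem p s))%N.
  by apply: eq_bigr => e _; rewrite fE dvdp_expr_prod.
(* The multiplicity of [p] is at most [M], so the range of e misses no power of [p] dividing [f]. *)
have cM : (count_mem p s <= M)%N by apply: leq_trans (count_size _ _) sM.
rewrite (big_cat_nat (n := (count_mem p s).+1))//= big_nat_cond.
rewrite (eq_bigr (fun=> 1%N)); last by move=> e; rewrite ltnS andbT => /andP[_ ->].
rewrite -big_nat_cond sum_nat_const_nat muln1 subn1/= big_nat_cond big1 ?addn0.
  rewrite -sum1_count big_mkcond/=; apply: eq_bigr => g _.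
  by rewrite eq_sym; case: eqP.
by move=> e; rewrite andbT => /andP[ce _]; rewrite leqNgt ce.
Qed.

(** The map g -> p^e g is a bijection from monics of degree n - ed onto the multiples of p^e of
    degree n; there are none if ed > n. *)
Lemma count_multiples (P : pred {poly K}) n d p e : p \in irreds d ->
  count (fun f => P f && (p ^+ e %| f)) (monics n) =
  if (e * d <= n)%N then count (fun g => P (p ^+ e * g)) (monics (n - e * d))
  else 0%N.
Proof.
move=> pd; have pe : p ^+ e \in monics (e * d).
  by apply: monicsX; move: pd; rewrite mem_filter => /andP[].
have := pe; rewrite mem_monics => /andP[mpe /eqP spe].
case: leqP => edn; last first.
  apply/eqP; rewrite -leqn0 leqNgt -has_count; apply/hasPn => f.
  rewrite mem_monics => /andP[mf /eqP sf]; rewrite negb_and; apply/orP; right.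
  by apply/negP => /dvdp_leq; rewrite monic_neq0// sf spe ltnS leqNgt edn => /(_ isT).
rewrite -(count_map (fun g => p ^+ e * g) P).
rewrite -!size_filter; apply/perm_size/uniq_perm.
- by rewrite filter_uniq// uniq_monics.
- rewrite filter_uniq// map_inj_uniq ?uniq_monics// => f g.
  by apply: mulfI; rewrite monic_neq0.
move=> f; rewrite !mem_filter -andbA; congr (_ && _).
apply/andP/mapP => [[/dvdpP[g ->] gn]|[g gn ->]]; last first.
  by rewrite dvdp_mulr// -[n in monics n](subnKC edn) monicsM.
exists g; last by rewrite mulrC.
have := gn; rewrite !mem_monics (monicMr _ mpe) => /andP[mg].
rewrite mg size_Mmonic ?monic_neq0// spe addnS/= => /eqP sg.
have g0 : (0 < size g)%N by rewrite size_poly_gt0 monic_neq0.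
by rewrite -subSn// -sg addnK.
Qed.

(** Double counting: the degrees of all [f] satisfying [P] are summed, first directly, then through
    the valuations. Taking products of k irreducibles for [P] gives the recursion for h_k; taking
    all monics gives the one for pi_d. *)
Lemma sum_deg_monics (P : pred {poly K}) n M : (n <= M)%N ->
  (n * count P (monics n) =
  \sum_(1 <= d < M.+1) \sum_(p <- irreds d) \sum_(1 <= e < M.+1)
    d * if (e * d <= n) then count (fun g => P (p ^+ e * g)%R) (monics (n - e * d))
        else 0)%N.
Proof.
move=> nM; transitivity (\sum_(f <- monics n | P f) n)%N.
  by rewrite big_const_seq iter_addn_0.
rewrite big_seq_cond (eq_bigr (fun f => \sum_(1 <= d < M.+1) \sum_(p <- irreds d)
   \sum_(1 <= e < M.+1) d * (p ^+ e %| f)%R)%N); last first.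
  by move=> f /andP[fn _]; rewrite (deg_valuations fn nM).
rewrite -big_seq_cond exchange_big/=; apply: eq_bigr => d _.
rewrite exchange_big/= !big_seq; apply: eq_bigr => p pd.
rewrite exchange_big/=; apply: eq_bigr => e _.
rewrite -count_multiples// -big_distrr/=; congr (_ * _)%N.
rewrite -sum1_count [RHS]big_mkcondr/=; apply: eq_bigr => f _.
by case: (_ %| _).
Qed.

(** * Counting products of k irreducibles *)

Definition Omega_count k n := count (fun f => `[< irrprod K k f >]) (monics n).

Lemma Omega_count_le k n : (Omega_count k n <= #|K| ^ n)%N.
Proof. by rewrite -size_monics count_size. Qed.

Lemma Omega_count00 : Omega_count 0 0 = 1%N.
Proof.
apply/eqP; rewrite eqn_leq; apply/andP; split; first exact: Omega_count_le.
rewrite -has_count; apply/hasP; exists 1.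
  by rewrite mem_monics monic1 size_poly1.
by apply/asboolP; exists [::]; rewrite big_nil.
Qed.

Lemma irrprod_deg k f : irrprod K k f -> f \is monic /\ (k <= deg f)%N.
Proof.
move=> [s [<- sP ->]]; split; first exact: monic_prod_irr.
rewrite deg_prod_irr// -sum1_size !big_seq; apply: leq_sum => g /sP.
exact: deg_irred_gt0.
Qed.

Lemma Omega_countS0 k : Omega_count k.+1 0 = 0%N.
Proof.
apply/eqP; rewrite -leqn0 leqNgt -has_count; apply/hasPn => f.
rewrite mem_monics => /andP[mf /eqP sf]; apply/asboolPn => /irrprod_deg[_].
by rewrite /deg sf.
Qed.

Lemma Omega_count_rec k n M : (n <= M)%N ->
  (n * Omega_count k n =
  \sum_(1 <= d < M.+1) \sum_(1 <= e < M.+1)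
    if (e * d <= n) && (e <= k) then
      d * size (irreds d) * Omega_count (k - e) (n - e * d) else 0)%N.
Proof.
move=> nM; rewrite /Omega_count (sum_deg_monics _ nM); apply: eq_bigr => d _.
rewrite exchange_big/=; apply: eq_bigr => e _.
rewrite big_seq (eq_bigr (fun=> if (e * d <= n)%N && (e <= k)%N then
   (d * Omega_count (k - e) (n - e * d))%N else 0%N)).
  rewrite -big_seq big_const_seq count_predT iter_addn_0.
  by case: ifP => // _; rewrite mulnAC.
move=> p /mem_irreds[pP _]; case: (leqP (e * d) n) => /= _; last by rewrite muln0.
case: leqP => ek.
  congr (_ * _)%N; apply: eq_count => g; apply/asbool_equiv_eq.
  by rewrite irrprodXM// ek; split=> [[]|].
apply/eqP; rewrite muln_eq0 -leqn0 [(count _ _ == _)%N]eqn_leq andbC/=.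
rewrite [(count _ _ <= 0)%N]leqNgt -has_count orbC.
by apply/orP; left; apply/hasPn => g _; apply/asboolPn; rewrite irrprodXM// leqNgt ek => -[].
Qed.

Lemma irreds_rec n M : (n <= M)%N ->
  (n * #|K| ^ n =
  \sum_(1 <= d < M.+1) \sum_(1 <= e < M.+1)
    if (e * d <= n) then d * size (irreds d) * #|K| ^ (n - e * d) else 0)%N.
Proof.
move=> nM; have := sum_deg_monics predT nM; rewrite count_predT size_monics => ->.
apply: eq_bigr => d _; rewrite exchange_big/=; apply: eq_bigr => e _.
rewrite big_const_seq count_predT iter_addn_0 count_predT size_monics.
by case: ifP => // _; rewrite ?muln0// mulnAC.
Qed.

End Counting.

(** * Recursions for the densities *)

Section Geometric.
Variable R : realFieldType.

Lemma sum_expr_le (y : R) m : 0 <= y -> y <= 4^-1 ->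
  (* The constant 4/3 is 1/(1 - 1/4), from the geometric series. *)
  \sum_(1 <= i < m.+1) y ^+ i <= 4 / 3 * y.
Proof.
move=> y0 y4; suff : \sum_(1 <= i < m.+1) y ^+ i <= 4 / 3 * (y - y ^+ m.+1).
  have := exprn_ge0 m.+1 y0; move: (y ^+ m.+1) => z; lra.
elim: m => [|m IHm]; first by rewrite big_geq// expr1 subrr mulr0.
rewrite big_nat_recr//= [y ^+ m.+2]exprSr; have := exprn_ge0 m.+1 y0.
move: IHm; move: (y ^+ m.+1) (\sum_(_ <= _ < _) _) => z S; nra.
Qed.

(** For fixed d the inner sum is geometric in x^d, hence at most (4/3) x^d; summing over d gives
    (16/9) x <= 2x. For M < 2 there is no exponent e >= 2. *)
Lemma sum_higher_powers_le (x : R) M : 0 <= x -> x <= 4^-1 ->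
  \sum_(1 <= d < M.+1) \sum_(2 <= e < M.+1) x ^+ (e.-1 * d) <= 2 * x *+ (2 <= M)%N.
Proof.
move=> x0 x4; case: (leqP 2 M) => M2; last first.
  by rewrite big1// => d _; rewrite big_geq.
apply: (@le_trans _ _ (\sum_(1 <= d < M.+1) 4 / 3 * x ^+ d)).
  rewrite big_nat [leRHS]big_nat; apply: ler_sum => d /andP[d1 _].
  case: M M2 => // M _; rewrite big_add1/=.
  under eq_bigr do rewrite mulnC exprM.
  apply: sum_expr_le; first exact: exprn_ge0.
  case: d d1 => // d _; rewrite exprS; apply: (le_trans _ x4).
  by rewrite ler_piMr ?exprn_ile1//; lra.
rewrite -mulr_sumr; have := sum_expr_le M x0 x4; rewrite mulr1n; lra.
Qed.

End Geometric.

Section Densities.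
Variables (R : realFieldType) (K : finFieldType).
Implicit Types (n d e k M : nat).

Let q : R := #|K|%:R.
Let x : R := q^-1.

(** This is h_k(n); [irr_dens] below is a_d. *)
Definition Omega_dens k n : R := (Omega_count K k n)%:R / q ^+ n.
Definition irr_dens d : R := (d * size (irreds K d))%:R / q ^+ d.

Let q0 : 0 < q.
Proof. by rewrite ltr0n; apply/card_gt0P; exists 0. Qed.

Lemma Omega_dens_ge0 k n : 0 <= Omega_dens k n.
Proof. by rewrite divr_ge0// exprn_ge0// ltW. Qed.

Lemma irr_dens_ge0 d : 0 <= irr_dens d.
Proof. by rewrite divr_ge0// exprn_ge0// ltW. Qed.

Lemma Omega_dens_le1 k n : Omega_dens k n <= 1.
Proof. by rewrite ler_pdivrMr ?exprn_gt0// mul1r -natrX ler_nat Omega_count_le. Qed.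

Lemma Omega_dens00 : Omega_dens 0 0 = 1.
Proof. by rewrite /Omega_dens Omega_count00 divr1. Qed.

Lemma Omega_densS0 k : Omega_dens k.+1 0 = 0.
Proof. by rewrite /Omega_dens Omega_countS0 mul0r. Qed.

Let expq n d e : (1 <= e)%N -> (e * d <= n)%N ->
  q ^+ n = q ^+ d * q ^+ (e.-1 * d) * q ^+ (n - e * d).
Proof.
move=> e1 edn; rewrite -!exprD -mulSn prednK//.
by rewrite subnKC.
Qed.

Lemma Omega_dens_rec k n M : (n <= M)%N ->
  n%:R * Omega_dens k n =
  \sum_(1 <= d < M.+1) \sum_(1 <= e < M.+1)
    if (e * d <= n)%N && (e <= k)%N then
      irr_dens d * x ^+ (e.-1 * d) * Omega_dens (k - e) (n - e * d) else 0.
Proof.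
move=> nM; rewrite /Omega_dens mulrA -natrM (Omega_count_rec K k nM).
rewrite natr_sum mulr_suml; apply: eq_bigr => d _.
rewrite natr_sum mulr_suml big_nat [RHS]big_nat; apply: eq_bigr => e /andP[e1 _].
case: ifP => [/andP[edn _]|_]; last by rewrite mul0r.
by rewrite (expq e1 edn) /irr_dens /x exprVn natrM; field; rewrite !expf_neq0 ?gt_eqF.
Qed.

Lemma irr_dens_rec n M : (n <= M)%N ->
  n%:R = \sum_(1 <= d < M.+1) \sum_(1 <= e < M.+1)
    if (e * d <= n)%N then irr_dens d * x ^+ (e.-1 * d) else 0.
Proof.
move=> nM; rewrite -[LHS](mulfK (_ : q ^+ n != 0)) ?expf_neq0 ?gt_eqF//.
rewrite -natrX -natrM (irreds_rec K nM).
rewrite natr_sum mulr_suml; apply: eq_bigr => d _.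
rewrite natr_sum mulr_suml big_nat [RHS]big_nat; apply: eq_bigr => e /andP[e1 _].
case: ifP => [edn|_]; last by rewrite mul0r.
rewrite natrM !natrX -/q (expq e1 edn) /irr_dens /x exprVn; field.
by rewrite !expf_neq0 ?gt_eqF.
Qed.

(** Gauss's formula sum_{d | n} d pi_d = q^n, normalized. It is the difference of [irr_dens_rec] at
    two consecutive degrees, in which only the pairs with ed = n survive. *)
Lemma irr_dens_convolution n : (1 <= n)%N ->
  1 = \sum_(1 <= d < n.+1) \sum_(1 <= e < n.+1)
    if (e * d == n)%N then irr_dens d * x ^+ (e.-1 * d) else 0.
Proof.
case: n => // n _; have := irr_dens_rec (leqnSn n).
have := irr_dens_rec (leqnn n.+1); rewrite -natr1 => E1 E2.
apply: (addrI n%:R); rewrite {}E1 E2 -big_split/=; apply: eq_bigr => d _.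
rewrite -big_split/=; apply: eq_bigr => e _.
rewrite (leq_eqVlt _ n.+1) ltnS; case: eqVneq => [->|_]; last by rewrite addr0.
by rewrite ltnn add0r.
Qed.

Lemma irr_dens_le1 n : (1 <= n)%N -> irr_dens n <= 1.
Proof.
move=> n1; rewrite [leRHS](irr_dens_convolution n1).
rewrite (bigD1_seq n) ?iota_uniq ?mem_index_iota ?n1 ?leqnn//=.
rewrite (bigD1_seq 1%N) ?iota_uniq ?mem_index_iota ?ltnS//=.
have t0 d e : 0 <= if (e * d == n)%N then irr_dens d * x ^+ (e.-1 * d) else 0.
  case: ifP => // _; rewrite mulr_ge0 ?irr_dens_ge0// exprn_ge0//.
  by rewrite invr_ge0 ltW.
rewrite mul1n eqxx mul0n expr0 mulr1 -addrA lerDl addr_ge0// sumr_ge0// => d _.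
by rewrite sumr_ge0.
Qed.

Hypothesis q4 : 4 <= q.

Let x0 : 0 <= x. Proof. by rewrite invr_ge0 ltW. Qed.
Let x4 : x <= 4^-1. Proof. by rewrite lef_pV2 ?posrE. Qed.

(** In Gauss's formula the e = 1 part is exactly a_n, and the terms with e >= 2 total at most 2x
    because each a_d <= 1. *)
Lemma irr_dens_ge n : (1 <= n)%N -> 1 - 2 * x <= irr_dens n.
Proof.
move=> n1; rewrite lerBlDl [leLHS](irr_dens_convolution n1).
under eq_bigr do rewrite big_ltn//=.
rewrite big_split/= addrC; apply: lerD.
  apply: le_trans (_ : 2 * x *+ (2 <= n)%N <= _); last first.
    by case: (leqP 2 n) => _; rewrite ?mulr1n ?mulr0n// mulr_ge0.
  apply: le_trans (sum_higher_powers_le n x0 x4).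
  rewrite big_nat [leRHS]big_nat; apply: ler_sum => d /andP[d1 _].
  apply: ler_sum => e _; case: ifP => _; last exact: exprn_ge0.
  by rewrite ler_piMl ?exprn_ge0// irr_dens_le1.
rewrite (bigD1_seq n) ?iota_uniq ?mem_index_iota ?n1 ?leqnn//=.
rewrite mul1n eqxx mul0n expr0 mulr1 big1 ?addr0// => d /negPf.
by rewrite mul1n => ->.
Qed.

Let conv_first k n : \sum_(1 <= d < n.+1) Omega_dens k (n - d) =
  \sum_(0 <= j < n) Omega_dens k j.
Proof.
rewrite big_add1/= big_nat_rev/= add0n big_nat [RHS]big_nat.
apply: eq_bigr => j /andP[_ jn]; congr Omega_dens.
by rewrite subnSK// subKn// ltnW.
Qed.

Let rec_split k n : (1 <= n)%N -> n%:R * Omega_dens k.+1 n =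
  \sum_(1 <= d < n.+1) irr_dens d * Omega_dens k (n - d) +
  \sum_(1 <= d < n.+1) \sum_(2 <= e < n.+1)
    if (e * d <= n)%N && (e <= k.+1)%N then
      irr_dens d * x ^+ (e.-1 * d) * Omega_dens (k.+1 - e) (n - e * d) else 0.
Proof.
move=> n1; rewrite (Omega_dens_rec _ (leqnn n)) -big_split/=.
rewrite big_nat [RHS]big_nat; apply: eq_bigr => d /andP[_ dn].
rewrite big_ltn//=; congr (_ + _).
by rewrite mul1n -ltnS dn/= mul0n expr0 mulr1 subn1.
Qed.

(** The e = 1 terms use a_d <= 1; the others use also h <= 1 and the double geometric sum. No e >= 2
    occurs when n = 1, so the error is absent there. *)
Lemma Omega_dens_step_le k n : (1 <= n)%N ->
  n%:R * Omega_dens k.+1 n <=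
  \sum_(0 <= j < n) Omega_dens k j + 2 * x *+ (2 <= n)%N.
Proof.
move=> n1; rewrite rec_split//; apply: lerD.
  rewrite -conv_first big_nat [leRHS]big_nat; apply: ler_sum => d /andP[d1 _].
  by rewrite ler_piMl ?Omega_dens_ge0 ?irr_dens_le1.
apply: le_trans (sum_higher_powers_le n x0 x4).
rewrite big_nat [leRHS]big_nat; apply: ler_sum => d /andP[d1 _].
apply: ler_sum => e _; case: ifP => _; last exact: exprn_ge0.
rewrite -[leRHS]mul1r -[leRHS]mulr1 ler_pM ?Omega_dens_le1 ?Omega_dens_ge0//.
  by rewrite mulr_ge0 ?irr_dens_ge0 ?exprn_ge0.
by rewrite ler_wpM2r ?exprn_ge0 ?irr_dens_le1.
Qed.

(** Only the e = 1 terms are kept, with a_d >= 1 - 2x >= 1/2. *)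
Lemma Omega_dens_step_ge k n : (1 <= n)%N ->
  2^-1 * \sum_(0 <= j < n) Omega_dens k j <= n%:R * Omega_dens k.+1 n.
Proof.
move=> n1; rewrite rec_split// -[leLHS]addr0; apply: lerD; last first.
  apply: sumr_ge0 => d _; apply: sumr_ge0 => e _; case: ifP => // _.
  apply: mulr_ge0 (Omega_dens_ge0 _ _); apply: mulr_ge0 (irr_dens_ge0 _) _.
  exact: exprn_ge0.
rewrite -conv_first mulr_sumr big_nat [leRHS]big_nat.
apply: ler_sum => d /andP[d1 _]; rewrite ler_wpM2r ?Omega_dens_ge0//.
by apply: le_trans (irr_dens_ge d1); move: x4; lra.
Qed.

End Densities.

(** * Weighted sums *)

Section WeightedSums.
Variables (R : realFieldType) (g h : nat -> R).
Hypothesis h0 : forall n, 0 <= h n.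

Let partial_ge0 n : 0 <= \sum_(0 <= j < n) h j.
Proof. exact: sumr_ge0. Qed.

(* The induction invariant carries the boundary term of the telescoping of
   [G j = (1/j + 1/(j+1)) / 2]. *)
Lemma weighted_sum_le (c : R) N : 0 <= c -> h 0%N = 0 ->
  (forall n, (1 <= n)%N ->
    n%:R * g n <= \sum_(0 <= j < n) h j + c *+ (2 <= n)%N) ->
  \sum_(1 <= n < N.+1) g n / n%:R <=
  \sum_(1 <= n < N.+1) h n / n%:R -
  2^-1 * \sum_(1 <= n < N.+1) h n / (n%:R * n.+1%:R) + c.
Proof.
move=> c0 h00 gP; pose G n : R := 2^-1 * (n%:R^-1 + n.+1%:R^-1).
case: N => [|N]; first by rewrite !big_geq// mulr0 subr0 add0r.
(* The error [c] enters only from n = 2 on, and 1/n^2 <= 1/(n-1) - 1/n, so its total telescopes to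
   at most c (1 - 1/(N+1)). *)
suff /le_trans : \sum_(1 <= n < N.+2) g n / n%:R <=
    \sum_(1 <= n < N.+2) h n * G n - G N.+1 * \sum_(0 <= j < N.+2) h j +
    c * (1 - N.+1%:R^-1).
  apply; apply: lerD.
    apply: (@le_trans _ _ (\sum_(1 <= n < N.+2) h n * G n)).
      by rewrite gerBl !mulr_ge0 ?addr_ge0 ?invr_ge0.
    rewrite mulr_sumr -sumrB.
    rewrite big_nat [leRHS]big_nat; apply: ler_sum => n /andP[n1 _].
    have n0 : n%:R != 0 :> R by rewrite pnatr_eq0 -lt0n.
    (* This is in fact an equality: G n = 1/n - 1/(2n(n+1)), which is where the saving comes
       from. *)
    rewrite le_eqVlt; apply/orP; left; apply/eqP; rewrite /G -natr1; field.
    by rewrite n0 addrC natr1 pnatr_eq0.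
  by rewrite ler_piMr// gerBl.
elim: N => [|N IHN].
  have := gP 1%N isT; rewrite !big_nat1 big_nat_recr//= big_nat1 h00 mulr0n.
  by rewrite invr1 => gP1; lra.
rewrite big_nat_recr//= [X in _ <= X - _ + _]big_nat_recr//=.
rewrite [X in _ <= _ - _ * X + _]big_nat_recr//=.
have := gP N.+2 isT; rewrite mulr1n.
move: IHN (partial_ge0 N.+2).
set S := \sum_(0 <= j < N.+2) h j; set A := \sum_(1 <= i < N.+2) g i / _.
set B := \sum_(1 <= i < N.+2) _ => IHN S0 gN.
have m0 : 0 < N.+1%:R :> R by rewrite ltr0n.
have gN' : g N.+2 / N.+2%:R <= (S + c) / N.+2%:R ^+ 2.
  rewrite expr2 invfM mulrA ler_wpM2r ?invr_ge0// ler_pdivlMr ?ltr0n//.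
  by rewrite mulrC.
have GE : N.+2%:R ^- 2 <= G N.+1 - G N.+2.
  have -> : G N.+1 - G N.+2 = (N.+1%:R * N.+3%:R)^-1.
    rewrite /G -!(natr1 N.+1) -!(natr1 N.+2) -!(natr1 N.+1); field.
    by move: m0; move: N.+1%:R => m m0; rewrite !gt_eqF//; lra.
  rewrite lef_pV2 ?posrE ?mulr_gt0 ?exprn_gt0 ?ltr0n//.
  by rewrite -natrM -natrX ler_nat -mulnn; lia.
have cE : N.+2%:R ^- 2 <= N.+1%:R^-1 - N.+2%:R^-1 :> R.
  have -> : N.+1%:R^-1 - N.+2%:R^-1 = (N.+1%:R * N.+2%:R)^-1 :> R.
    rewrite -!(natr1 N.+1); field.
    by move: m0; move: N.+1%:R => m m0; rewrite !gt_eqF//; lra.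
  rewrite lef_pV2 ?posrE ?mulr_gt0 ?exprn_gt0 ?ltr0n//.
  by rewrite -natrM -natrX ler_nat -mulnn; lia.
have := ler_wpM2l S0 GE; have := ler_wpM2l c0 cE; move: IHN gN'.
move: (N.+2%:R ^- 2) (G N.+1) (G N.+2) (N.+1%:R^-1) (g N.+2 / _) => w G1 G2 m gn.
move: (N.+2%:R^-1) => m2.
lra.
Qed.

Let v n : R := (n.+1%:R * n.+2%:R)^-1.

(** The weight [v] reproduces itself: v(n-1) - v(n) = 2 v(n)/n, so each h(j) collects v(j)/2 from
    later n, and the factor 1/2 in the hypothesis makes it v(j)/4. Truncation at [N] costs v(N)
    times a sum of at most N + 1, that is 1/(N+2). *)
Lemma weighted_sum_ge N : (forall n, h n <= 1) ->
  (forall n, (1 <= n)%N -> 2^-1 * \sum_(0 <= j < n) h j <= n%:R * g n) ->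
  0 <= g 0%N ->
  4^-1 * (\sum_(0 <= n < N.+1) h n / (n.+1%:R * n.+2%:R) - N.+2%:R^-1) <=
  \sum_(0 <= n < N.+1) g n / (n.+1%:R * n.+2%:R).
Proof.
move=> h1 gP g0; suff : 4^-1 * (\sum_(0 <= n < N.+1) h n * v n -
    v N * \sum_(0 <= n < N.+1) h n) <= \sum_(0 <= n < N.+1) g n * v n.
  apply: le_trans; rewrite ler_wpM2l// lerB//.
  apply: (@le_trans _ _ (v N * \sum_(0 <= n < N.+1) 1)).
    by rewrite ler_wpM2l ?invr_ge0 ?mulr_ge0//; apply: ler_sum.
  rewrite big_const_nat subn0 iter_addr_0 /v -[1 *+ _]/(N.+1%:R) invfM mulrAC mulVf ?pnatr_eq0//.
  by rewrite mul1r.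
elim: N => [|N IHN].
  by rewrite !big_nat1 (mulrC (h _)) subrr mulr0 mulr_ge0 ?invr_ge0 ?mulr_ge0.
rewrite big_nat_recr//= [X in _ * (_ - _ * X)]big_nat_recr//= [leRHS]big_nat_recr//=.
have := gP N.+1 isT; move: IHN (partial_ge0 N.+1).
set S := \sum_(0 <= j < N.+1) h j; set A := \sum_(0 <= i < N.+1) h i * _.
set B := \sum_(0 <= i < N.+1) _ => IHN S0 gN.
have gN' : 2^-1 * S * (v N.+1 / N.+1%:R) <= g N.+1 * v N.+1.
  have -> : g N.+1 * v N.+1 = (N.+1%:R * g N.+1) * (v N.+1 / N.+1%:R).
    by rewrite mulrC [_%:R * _]mulrC -mulrA [_%:R * _]mulrCA divff ?pnatr_eq0// mulr1 mulrC.
  by rewrite ler_wpM2r// divr_ge0// invr_ge0 mulr_ge0.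
have vE : v N - v N.+1 = 2 * (v N.+1 / N.+1%:R).
  rewrite /v -!(natr1 N.+2) -!(natr1 N.+1); have m0 : 0 < N.+1%:R :> R by rewrite ltr0n.
  by field; move: m0; move: N.+1%:R => m m0; rewrite !gt_eqF//; lra.
(* The new term h(N+1) v(N+1) cancels against the boundary; what the boundary loses on [S], times
   1/4, is the lower bound [gN']. *)
suff -> : v N.+1 * (S + h N.+1) = v N * S - 2 * (v N.+1 / N.+1%:R) * S + h N.+1 * v N.+1.
  by move: IHN gN'; move: (v N.+1 / _) (v N) (g _ * _) (h _ * _) => *; lra.
by rewrite -vE; ring.
Qed.

End WeightedSums.

(** * Comparing consecutive sums *)

Lemma sum_inv_sqr_le (R : realFieldType) N :
  \sum_(1 <= n < N.+1) (n%:R ^+ 2)^-1 <= 2 :> R.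
Proof.
case: N => [|N]; first by rewrite big_geq.
suff : \sum_(1 <= n < N.+2) (n%:R ^+ 2)^-1 <= 2 - N.+1%:R^-1 :> R.
  by move=> /le_trans; apply; rewrite gerBl.
elim: N => [|N IHN]; first by rewrite big_nat1 expr1n invr1; lra.
rewrite big_nat_recr//=.
suff : (N.+2%:R ^+ 2)^-1 <= N.+1%:R^-1 - N.+2%:R^-1 :> R.
  by move: IHN; move: (_ ^+ 2)^-1 N.+1%:R^-1 N.+2%:R^-1 => *; lra.
have -> : N.+1%:R^-1 - N.+2%:R^-1 = (N.+1%:R * N.+2%:R)^-1 :> R.
  rewrite -!(natr1 N.+1); have m0 : 0 < N.+1%:R :> R by rewrite ltr0n.
  by field; move: m0; move: N.+1%:R => m m0; rewrite !gt_eqF//; lra.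
rewrite lef_pV2 ?posrE ?mulr_gt0 ?exprn_gt0 ?ltr0n//.
by rewrite -natrM -natrX ler_nat -mulnn; lia.
Qed.

(** * Truncated sums: the quantitative drop from F_k to F_{k+1} *)

Section PartialSums.
Variables (R : realFieldType) (K : finFieldType).
Let q : R := #|K|%:R.
Hypothesis q4 : 4 <= q.

Definition erdos_psum k N : R :=
  \sum_(1 <= n < N.+1) Omega_dens R K k n / n%:R.

Let q0 : 0 < q. Proof. by apply: lt_le_trans q4. Qed.
Let qV0 : 0 <= q^-1. Proof. by rewrite invr_ge0 ltW. Qed.

(** Each step divides the main term by 4, starting from h_0(0) v(0) = 1/2. The coefficient 1/3 of
    the truncation error is the fixed point of c -> (c + 1)/4. *)
Lemma Omega_dens_damped_ge k N :
  2^-1 * 4^-1 ^+ k - 3^-1 / N.+2%:R <=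
  \sum_(0 <= n < N.+1) Omega_dens R K k n / (n.+1%:R * n.+2%:R).
Proof.
elim: k => [|k IHk].
  apply: (@le_trans _ _ 2^-1); first by rewrite mulr1 gerBl divr_ge0.
  rewrite big_ltn// Omega_dens00 !mul1r lerDl sumr_ge0// => n _.
  by rewrite divr_ge0 ?Omega_dens_ge0 ?mulr_ge0.
have := weighted_sum_ge (Omega_dens_ge0 R K k) N (Omega_dens_le1 R K k)
  (Omega_dens_step_ge q4 k) (Omega_dens_ge0 _ _ _ _).
apply: le_trans; rewrite exprS; move: IHk; move: (N.+2%:R^-1) (\sum_(_ <= _ < _) _) => m S.
move: (4^-1 ^+ k) => t; lra.
Qed.

Lemma erdos_psum_step k N : 16 * 4 ^+ k.+1 <= q ->
  erdos_psum k.+2 N <=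
  erdos_psum k.+1 N - 8^-1 * 4^-1 ^+ k.+1 + 6^-1 / N.+2%:R.
Proof.
move=> qk; have x2 : 0 <= 2 * q^-1 by rewrite mulr_ge0.
have := weighted_sum_le (Omega_dens_ge0 R K k.+1) N x2 (Omega_densS0 R K k)
  (Omega_dens_step_le q4 k.+1).
rewrite -/(erdos_psum _ _) -/(erdos_psum _ _) => /le_trans; apply.
(* With t = 4^-(k+1) the error 2x is at most t/8, half of the saving t/4. *)
have xk : q^-1 <= 16^-1 * 4^-1 ^+ k.+1.
  by rewrite exprVn -invfM lef_pV2 ?posrE// mulr_gt0// exprn_gt0.
(* The weight is shifted by one to the smaller v(n); the added n = 0 term vanishes since h_{k+1}(0)
   = 0. *)
have : \sum_(0 <= n < N.+1) Omega_dens R K k.+1 n / (n.+1%:R * n.+2%:R) <=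
       \sum_(1 <= n < N.+1) Omega_dens R K k.+1 n / (n%:R * n.+1%:R).
  rewrite big_ltn// Omega_densS0 mul0r add0r big_nat [leRHS]big_nat.
  apply: ler_sum => n /andP[n1 _]; rewrite ler_wpM2l ?Omega_dens_ge0//.
  rewrite lef_pV2 ?posrE ?mulr_gt0 ?ltr0n// mulrC ler_wpM2l// ler_nat.
  by rewrite (leq_trans (leqnSn n)).
have := Omega_dens_damped_ge k.+1 N.
move: (\sum_(0 <= _ < _) _) (\sum_(1 <= _ < _) _) (4^-1 ^+ k.+1) xk => V B t.
move: (q^-1) (N.+2%:R^-1) => x m; lra.
Qed.

Lemma Omega_dens0S n : Omega_dens R K 0 n.+1 = 0.
Proof.
rewrite /Omega_dens; suff -> : Omega_count K 0 n.+1 = 0%N by rewrite mul0r.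
apply/eqP; rewrite -leqn0 leqNgt -has_count; apply/hasPn => f.
rewrite mem_monics => /andP[_ /eqP sf]; apply/asboolPn => -[s [/size0nil-> _ f1]].
by move: sf; rewrite f1 big_nil size_poly1.
Qed.

(** Finiteness of the sums is what lets a fixed gap become a strict inequality in the extended
    reals. For F_1, h_1(n) <= (1 + 2x)/n <= 2/n; each later sum grows by at most 2x. *)
Lemma erdos_psum_bounded k : exists C, forall N, erdos_psum k.+1 N <= C.
Proof.
elim: k => [|k [C CP]].
  exists 4 => N; apply: (@le_trans _ _ (2 * \sum_(1 <= n < N.+1) (n%:R ^+ 2)^-1)).
    rewrite mulr_sumr /erdos_psum big_nat [leRHS]big_nat; apply: ler_sum => n /andP[n1 _].
    have n0 : 0 < n%:R :> R by rewrite ltr0n.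
    rewrite expr2 invfM mulrA ler_wpM2r ?invr_ge0 ?ler0n// ler_pdivlMr// mulrC.
    apply: le_trans (Omega_dens_step_le q4 0 n1) _.
    have -> : \sum_(0 <= j < n) Omega_dens R K 0 j = 1.
      by case: n n1 {n0} => // n _; rewrite big_ltn// Omega_dens00 big_add1 big1 ?addr0// => i _; exact: Omega_dens0S.
    have x4 : q^-1 <= 4^-1 by rewrite lef_pV2 ?posrE.
    by rewrite -/q; case: (leqP 2 n) => _; rewrite ?mulr1n ?mulr0n; move: x4; lra.
  by have := sum_inv_sqr_le R N; lra.
exists (C + 2 * q^-1) => N; have x2 : 0 <= 2 * q^-1 by rewrite mulr_ge0.
have := weighted_sum_le (Omega_dens_ge0 R K k.+1) N x2 (Omega_densS0 R K k)
  (Omega_dens_step_le q4 k.+1).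
rewrite -/(erdos_psum _ _) -/(erdos_psum _ _) => /le_trans; apply.
rewrite lerD2r lerBlDr ler_wpDr// mulr_ge0// sumr_ge0// => n _.
by rewrite divr_ge0 ?Omega_dens_ge0 ?mulr_ge0.
Qed.

End PartialSums.

(** * From truncated sums to the infinite sums *)

Section ErdosSum.
Variables (R : realType) (K : finFieldType).

Let q0 : 0 < #|K|%:R :> R.
Proof. by rewrite ltr0n; apply/card_gt0P; exists 0. Qed.

Definition irrprods_upto k N : seq {poly K} :=
  [seq f | n <- index_iota 1 N.+1, f <- [seq f <- monics K n | `[< irrprod K k f >]]].

Lemma mem_irrprods_upto k N f :
  f \in irrprods_upto k.+1 N <-> irrprod K k.+1 f /\ (deg f <= N)%N.
Proof.
split=> [/allpairsPdep[n [g [+ + ->]]]|[fk fN]].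
  rewrite mem_index_iota mem_filter mem_monics ltnS.
  by move=> /andP[_ nN] /andP[/asboolP gk /andP[_ /eqP sg]]; rewrite /deg sg.
have [mf kf] := irrprod_deg fk.
apply/allpairsPdep; exists (deg f), f; split=> //.
  by rewrite mem_index_iota ltnS fN (leq_trans _ kf).
rewrite mem_filter mem_monics mf asboolT//= /deg prednK//.
by rewrite size_poly_gt0 monic_neq0.
Qed.

Lemma uniq_irrprods_upto k N : uniq (irrprods_upto k N).
Proof.
apply: allpairs_uniq_dep; first exact: iota_uniq.
  by move=> n _; rewrite filter_uniq// uniq_monics.
move=> _ _ /allpairsPdep[n [f [_ + ->]]] /allpairsPdep[m [g [_ + ->]]]/=.
rewrite !mem_filter !mem_monics => /andP[_ /andP[_ /eqP sf]] /andP[_ /andP[_ /eqP sg]] fg.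
by move: sf sg; rewrite fg => -> [->].
Qed.

Lemma sum_irrprods_upto k N :
  \sum_(f <- irrprods_upto k N) (#|K|%:R ^+ deg f * (deg f)%:R)^-1 =
  erdos_psum R K k N.
Proof.
rewrite big_allpairs_dep; apply: eq_bigr => n _.
rewrite big_filter big_seq_cond.
rewrite (eq_bigr (fun=> (#|K|%:R ^+ n * n%:R)^-1)); last first.
  by move=> f /andP[+ _]; rewrite mem_monics /deg => /andP[_ /eqP->].
rewrite -big_seq_cond big_const_seq iter_addr_0 /Omega_dens /Omega_count.
by rewrite invfM -mulrA mulr_natl.
Qed.

(** A finite set of products lies in a truncation at its largest degree, so the truncations are
    cofinal among finite subsums. *)
Lemma erdos_sum_irrprod k : erdos_sum R (irrprod K k.+1) =
  ereal_sup (range (fun N => (erdos_psum R K k.+1 N)%:E)).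
Proof.
pose w (f : {poly K}) : R := (#|K|%:R ^+ deg f * (deg f)%:R)^-1.
have sumE N : (\sum_(f \in [set` irrprods_upto k.+1 N]) (w f)%:E)%E =
    (erdos_psum R K k.+1 N)%:E.
  by rewrite -fsbig_seq ?uniq_irrprods_upto// sumEFin -sum_irrprods_upto.
apply/eqP; rewrite eq_le; apply/andP; split; last first.
  apply: ge_ereal_sup => _ [N _ <-]; apply: esum_ge.
  exists [set` irrprods_upto k.+1 N]; last by rewrite sumE.
  by split; [exact: finite_seq|move=> f /= /mem_irrprods_upto[]].
apply: ge_ereal_sup => _ [X [finX Xk] <-].
have [s XE] := (finite_seqP X).1 finX.
pose N := (\max_(f <- s) deg f)%N.
apply: (@le_trans _ _ (erdos_psum R K k.+1 N)%:E); last first.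
  by apply: ereal_sup_ubound; exists N.
rewrite -sumE; apply: lee_fsum_nneg_subset => //; first exact: finite_seq.
  move=> f; rewrite inE => Xf; rewrite inE/=; apply/mem_irrprods_upto.
  split; first exact: Xk.
  by apply: (@leq_bigmax_seq _ _ xpredT (@deg K)) => //; move: Xf; rewrite XE.
Qed.

Lemma erdos_sum_lt k : (16 * 4 ^ k.+1 <= #|K|)%N ->
  (erdos_sum R (irrprod K k.+2) < erdos_sum R (irrprod K k.+1))%E.
Proof.
move=> qk; have qk' : 16 * 4 ^+ k.+1 <= #|K|%:R :> R by rewrite -natrX -natrM ler_nat.
have q4 : 4 <= #|K|%:R :> R.
  rewrite ler_nat; apply: leq_trans qk; rewrite expnS mulnCA leq_pmulr//.
  by rewrite muln_gt0 expn_gt0.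
have [C CP] := erdos_psum_bounded q4 k.
rewrite !erdos_sum_irrprod.
set S := ereal_sup (range (fun N => (erdos_psum R K k.+1 N)%:E)).
have S_ub N : ((erdos_psum R K k.+1 N)%:E <= S)%E by apply: ereal_sup_ubound; exists N.
have Sfin : S \is a fin_num.
  rewrite fin_numElt (lt_le_trans (ltNyr _) (S_ub 0%N))/=.
  by apply: le_lt_trans (ltry C); apply: ge_ereal_sup => _ [N _ <-]; rewrite lee_fin.
have {}S_ub N : erdos_psum R K k.+1 N <= fine S by rewrite -lee_fin fineK.
rewrite -(fineK Sfin).
pose t : R := 4^-1 ^+ k.+1.
have t0 : 0 < t by rewrite exprn_gt0.
apply: (@le_lt_trans _ _ (fine S - 16^-1 * t)%:E); last by rewrite lte_fin; lra.
apply: ge_ereal_sup => _ [N _ <-]; rewrite lee_fin.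
(* Truncated sums increase with [N], so [N] may be enlarged until 1/(M+2) <= t/3; the drop is then
   at least t/8 - t/18 > t/16, uniformly in [N]. *)
pose M := maxn N (Num.truncn (3 * t^-1)).
apply: (@le_trans _ _ (erdos_psum R K k.+2 M)).
  rewrite /erdos_psum (big_cat_nat (n := N.+1) (p := M.+1))//= ?ltnS ?leq_maxl//.
  by rewrite lerDl sumr_ge0// => n _; rewrite divr_ge0 ?Omega_dens_ge0.
apply: le_trans (erdos_psum_step q4 M qk') _.
have : M.+2%:R^-1 <= 3^-1 * t.
  rewrite -[leRHS]invrK lef_pV2 ?posrE ?invr_gt0 ?mulr_gt0 ?invr_gt0//.
  rewrite invfM invrK (le_trans (ltW (truncnS_gt _)))// ler_nat.
  by rewrite ltnW// !ltnS leq_maxr.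
have := S_ub M; rewrite -/t; move: (erdos_psum _ _ _ _) (M.+2%:R^-1) => A m.
lra.
Qed.

End ErdosSum.

(** * The bound on zeta and the choice of q_k *)

Lemma zeta_ge1 (R : realType) k : (2 <= k)%N -> 1 <= zeta (k%:R : R).
Proof.
move=> k2; rewrite /zeta; set u := (fun n : nat => _).
have uE n : u n = n.+1%:R ^- k by rewrite /u powR_invn.
have u_ge0 n : 0 <= u n by rewrite uE invr_ge0 exprn_ge0.
have u_nd : nondecreasing_seq (series u).
  by apply: nondecreasing_series => n _ _; exact: u_ge0.
(* Convergence must be known before [limn] bounds the partial sums; comparison with the sum of 1/n^2
   gives it, and the first term is 1. *)
have u_cvg : cvgn (series u).
  apply: nondecreasing_is_cvgn => //; exists 2 => _ [N _ <-].
  apply: le_trans (sum_inv_sqr_le R N); rewrite big_add1 /series/=.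
  apply: ler_sum => n _; rewrite uE lef_pV2 ?posrE ?exprn_gt0//.
  by rewrite ler_weXn2l// ler1n.
apply: le_trans (nondecreasing_cvgn_le u_nd u_cvg 1%N).
by rewrite /series/= big_nat1 uE expr1n invr1.
Qed.

Theorem theorem5p9 (R : realType) :
  exists q_ : nat -> int,
    [/\ (forall k : nat, (1 <= k)%N ->
          forall Fq : finFieldType, q_ k <= #|Fq|%:Z ->
          forall j : nat, (1 <= j < k)%N ->
            (erdos_sum R (irrprod Fq j) > erdos_sum R (irrprod Fq j.+1))%E),
        (fun k : nat => (q_ k)%:~R : R) =O_\oo
          (fun k : nat => k%:R ^+ 2 * 4 ^+ k : R) &
        (forall k : nat, (2 <= k)%N ->
          (q_ k)%:~R < 403 / 100 * (k%:R - 1) ^+ 2 * 4 ^+ k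
                         * zeta (k%:R : R) ^+ 2)].
Proof.
(* For k >= 2 this is at least 16 * 4^(k-1), the largest threshold among the comparisons; for k = 1
   there is nothing to compare. The explicit bound follows from 4 < 4.03 and zeta(k) >= 1. *)
exists (fun k => (4 * k.-1 ^ 2 * 4 ^ k)%N%:Z).
have qE k : ((4 * k.-1 ^ 2 * 4 ^ k)%N%:Z)%:~R = 4 * k.-1%:R ^+ 2 * 4 ^+ k :> R.
  by rewrite -pmulrn !natrM !natrX.
split.
- move=> k _ Fq qk [|j]// /andP[_ jk]; apply: erdos_sum_lt.
  rewrite lez_nat in qk; apply: leq_trans qk.
  case: k jk => // k; rewrite ltnS/= => jk.
  have k1 : (0 < k)%N by apply: leq_ltn_trans jk.
  rewrite (expnS 4 k) mulnA; apply: leq_mul; last by rewrite leq_exp2l.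
  by rewrite -[16%N]/(4 * 1 * 4)%N !leq_mul// expn_gt0 k1.
- apply/eqO_exP; exists 4 => //; apply: filterE => k /=; rewrite qE.
  rewrite -mulrA normrM ger0_norm// ler_wpM2l//.
  rewrite !ger0_norm ?mulr_ge0 ?exprn_ge0//.
  by rewrite ler_wpM2r ?exprn_ge0// lerXn2r ?nnegrE// ler_nat leq_pred.
- move=> k k2; rewrite qE; case: k k2 => // k k1 /=.
  have := zeta_ge1 R k1; set z := zeta _ => z1; rewrite -(natr1 k) addrK.
  have z2 : 1 <= z ^+ 2 by rewrite exprn_ege1.
  have : 0 < k%:R ^+ 2 * 4 ^+ k.+1 :> R by rewrite mulr_gt0 ?exprn_gt0// ltr0n.
  rewrite -[4 * _ * _]mulrA -[403 / 100 * _ * _]mulrA.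
  move: (_ * _ ^+ k.+1) (z ^+ 2) z2 => P w w1 P0; nra.
Qed.
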